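(* Let $(\mathcal G\xrightarrow{\pi}M,\omega)$ be a regular, normal parabolic geometry of type $(G,P)$. The set of regular points is open and dense in $M$.
   Context: $G$ is a real or complex semisimple Lie group, $P\subset G$ a parabolic subgroup; $M$ is connected, and the geometry is smooth (real case) or holomorphic (complex case). $\mathfrak g=\mathrm{Lie}(G)$ has the grading $\mathfrak g=\bigoplus_{j=-\nu}^{\nu}\mathfrak g_j$ with $\mathfrak p=\mathrm{Lie}(P)=\mathfrak g_{\ge0}$, $\mathfrak g_{<0}$ generated by $\mathfrak g_{-1}$, and $\mathfrak g^i=\bigoplus_{j\ge i}\mathfrak g_j$. A parabolic geometry of type $(G,P)$ is a principal right $P$-bundle $\pi:\mathcal G\to M$ with a Cartan connection $\omega\in\Omega^1(\mathcal G,\mathfrak g)$ ($P$-equivariant, reproducing generators of fundamental vector fields, with each $\omega_u:T_u\mathcal G\to\mathfrak g$ an isomorphism) and curvature function $\kappa:\mathcal G\to\bigwedge^2(\mathfrak g/\mathfrak p)^*\otimes\mathfrak g$ given by $d\omega+\frac12[\omega,\omega]$. Regular: $\kappa(\mathfrak g^i,\mathfrak g^j)\subset\mathfrak g^{i+j+1}$ for $i,j<0$; normal: $\partial^*\kappa=0$ with $\partial^*$ the Kostant codifferential on $\bigwedge^2\mathfrak p_+\otimes\mathfrak g\cong\bigwedge^2(\mathfrak g/\mathfrak p)^*\otimes\mathfrak g$, $\mathfrak p_+=\mathfrak g^1$. $\mathfrak{inf}(\mathcal G,\omega)$ is the Lie algebra of $P$-invariant vector fields $\xi$ on $\mathcal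 G$ with $\mathcal L_\xi\omega=0$. For $u\in\mathcal G$ put $\mathfrak f(u)=\{\omega(\xi(u)):\xi\in\mathfrak{inf}(\mathcal G,\omega)\}\subset\mathfrak g$ and $\mathfrak s_j(u)=(\mathfrak f(u)\cap\mathfrak g^j)/(\mathfrak f(u)\cap\mathfrak g^{j+1})$; $\dim\mathfrak s_j(u)$ depends only on $x=\pi(u)$ and is written $\dim\mathfrak s_j(x)$. A point $x\in M$ is regular if there is a neighbourhood $N_x\subset M$ of $x$ such that for every $-\nu\le j\le\nu$ the function $y\mapsto\dim\mathfrak s_j(y)$ is constant on $N_x$. *)

(* Defs.v *)
(* MathComp / MathComp-Analysis.  The real (smooth) and complex (holomorphic)
   theories are developed uniformly over a field [K]; the statement restricts
   [K] to be the reals or the complex numbers.  "Smooth over K" is C^infinity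
   for K-differentiability, i.e. C^infinity for K = R and holomorphic for
   K = C. *)
From HB Require Import structures.
From mathcomp Require Import all_boot all_order all_algebra.
From mathcomp Require Import complex.
From mathcomp Require Import all_classical all_reals all_analysis.

Set Implicit Arguments.
Unset Strict Implicit.
Unset Printing Implicit Defensive.

Import Order.TTheory GRing.Theory Num.Theory.
Import numFieldNormedType.Exports.

Local Open Scope classical_set_scope.
Local Open Scope ring_scope.

Section Smoothness.
Variables (K : numFieldType) (E F : normedModType K).

Fixpoint Ck (k : nat) (D : set E) (f : E -> F) : Prop :=
  match k with
  | 0 => forall x, D x -> {for x, continuous f}
  | k'.+1 => (forall x, D x -> differentiable f x) /\
             (forall v : E, Ck k' D (fun x => 'd f x v))
  end.

(* Meaningful for D open. *)
Definition Csmooth (D : set E) (f : E -> F) : Prop := forall k, Ck k D f.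

End Smoothness.

Section Manifolds.
Variable K : numFieldType.

Record chart (n : nat) (T : topologicalType) := Chart {
  cdom : set T;
  cfun : T -> 'rV[K]_n;
  cinv : 'rV[K]_n -> T;
  cdom_open : open cdom;
  ccod_open : open (cfun @` cdom);
  cfunK : forall x, cdom x -> cinv (cfun x) = x;
  cfun_cont : forall x, cdom x -> {for x, continuous cfun};
  cinv_cont : forall e, (cfun @` cdom) e -> {for e, continuous cinv} }.

Definition trans (n : nat) (T : topologicalType) (c c' : chart n T) :
  'rV[K]_n -> 'rV[K]_n := cfun c' \o cinv c.

(* The atlas is presented as a family of charts indexed by the points, the
   chart [mchart x] being defined around [x]; every atlas has such a
   subatlas. *)
Record manifold := Manifold {
  mcar :> topologicalType;
  mdim : nat;
  mchart : mcar -> chart mdim mcar;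
  mchartP : forall x, cdom (mchart x) x;
  mtransP : forall x y,
    Csmooth (cfun (mchart x) @` (cdom (mchart x) `&` cdom (mchart y)))
            (trans (mchart x) (mchart y));
  mhausdorff : hausdorff_space mcar;
  mcountable : @second_countable mcar }.

(* A tangent vector at [x] is represented by its components in the preferred
   chart [mchart x]. *)
Definition tangent (M : manifold) (x : M) := 'rV[K]_(mdim M).

Definition mpos (M : manifold) (x : M) : 'rV[K]_(mdim M) := cfun (mchart x) x.

Definition rep (M N : manifold) (f : M -> N) (x : M) (y : N) :
  'rV[K]_(mdim M) -> 'rV[K]_(mdim N) :=
  cfun (mchart y) \o f \o cinv (mchart x).

Definition smooth_on (M N : manifold) (D : set M) (f : M -> N) : Prop :=
  (forall x, D x -> {for x, continuous f}) /\
  (forall (x : M) (y : N),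
     Csmooth (cfun (mchart x) @`
                (D `&` cdom (mchart x) `&` f @^-1` cdom (mchart y)))
             (rep f x y)).

Definition smooth (M N : manifold) (f : M -> N) : Prop := smooth_on setT f.

(* Smoothness of a map on an open subset of a product of two manifolds. *)
Definition smooth2_on (M M' N : manifold) (D : set (M * M'))
    (f : M -> M' -> N) : Prop :=
  (forall p, D p -> {for p, continuous (fun q : M * M' => f q.1 q.2)}) /\
  (forall (x : M) (x' : M') (y : N),
     Csmooth
       [set (cfun (mchart x) p.1, cfun (mchart x') p.2) |
         p in D `&` [set p | cdom (mchart x) p.1 /\ cdom (mchart x') p.2 /\
                             cdom (mchart y) (f p.1 p.2)]]
       (fun e : 'rV[K]_(mdim M) * 'rV[K]_(mdim M') =>
          cfun (mchart y) (f (cinv (mchart x) e.1) (cinv (mchart x') e.2)))).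

Definition smooth2 (M M' N : manifold) (f : M -> M' -> N) : Prop :=
  smooth2_on setT f.

Definition dmap (M N : manifold) (f : M -> N) (x : M) (v : tangent x) :
  tangent (f x) := 'd (rep f x (f x)) (mpos x) v.

Definition vfield (M : manifold) := forall x : M, tangent x.

(* Components of a vector field in the chart [mchart x0]. *)
Definition vf_coord (M : manifold) (xi : vfield M) (x0 : M)
    (e : 'rV[K]_(mdim M)) : 'rV[K]_(mdim M) :=
  let q := cinv (mchart x0) e in
  'd (trans (mchart q) (mchart x0)) (mpos q) (xi q).

Definition smooth_vf (M : manifold) (xi : vfield M) : Prop :=
  forall x0 : M, Csmooth (cfun (mchart x0) @` cdom (mchart x0)) (vf_coord xi x0).

Definition vf_bracket (M : manifold) (xi eta : vfield M) : vfield M :=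
  fun x => 'd (vf_coord eta x) (mpos x) (xi x)
           - 'd (vf_coord xi x) (mpos x) (eta x).

Definition oneform (M : manifold) (m : nat) :=
  forall x : M, 'Hom('rV[K]_(mdim M), 'rV[K]_m).

Definition of_coord (M : manifold) (m : nat) (om : oneform M m) (x0 : M)
    (e v : 'rV[K]_(mdim M)) : 'rV[K]_m :=
  let q := cinv (mchart x0) e in
  om q ('d (trans (mchart x0) (mchart q)) e v).

Definition smooth_of (M : manifold) (m : nat) (om : oneform M m) : Prop :=
  forall (x0 : M) (v : 'rV[K]_(mdim M)),
    Csmooth (cfun (mchart x0) @` cdom (mchart x0))
            (fun e => of_coord om x0 e v).

Definition ext_d (M : manifold) (m : nat) (om : oneform M m) (x : M)
    (v w : tangent x) : 'rV[K]_m :=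
  'd (fun e => of_coord om x e w) (mpos x) v
  - 'd (fun e => of_coord om x e v) (mpos x) w.

(* (L_xi om)_x(v); in coordinates d(om(v)) xi + om(d xi (v)), v constant. *)
Definition lie_der (M : manifold) (m : nat) (xi : vfield M) (om : oneform M m)
    (x : M) (v : tangent x) : 'rV[K]_m :=
  'd (fun e => of_coord om x e v) (mpos x) (xi x)
  + om x ('d (vf_coord xi x) (mpos x) v).

End Manifolds.

Arguments dmap {K M N} f x v.
Arguments ext_d {K M m} om x v w.
Arguments lie_der {K M m} xi om x v.

Section LieGroups.
Variable K : numFieldType.

Record lie_group := LieGroup {
  gman :> manifold K;
  gone : gman;
  gmul : gman -> gman -> gman;
  ginv : gman -> gman;
  gmulA : forall a b c, gmul a (gmul b c) = gmul (gmul a b) c;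
  gmul1 : forall a, gmul a gone = a;
  g1mul : forall a, gmul gone a = a;
  gmulV : forall a, gmul a (ginv a) = gone;
  gVmul : forall a, gmul (ginv a) a = gone;
  gmul_smooth : smooth2 gmul;
  ginv_smooth : smooth ginv }.

Definition lie (G : lie_group) := 'rV[K]_(mdim G).

Definition left_inv (G : lie_group) (X : lie G) : vfield G :=
  fun a => dmap (gmul a) (gone G : G) X.

Definition brk (G : lie_group) (X Y : lie G) : lie G :=
  vf_bracket (left_inv X) (left_inv Y) (gone G : G).

Definition conj_map (G : lie_group) (a : G) : G -> G :=
  fun b => gmul (gmul a b) (ginv a).

Definition Ad (G : lie_group) (a : G) (X : lie G) : lie G :=
  dmap (conj_map a) (gone G : G) X.

Definition killing (G : lie_group) (X Y : lie G) : K :=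
  \tr (lin1_mx (fun Z : lie G => brk X (brk Y Z))).

Definition ideal (G : lie_group) (U : {vspace lie G}) : Prop :=
  forall X Y : lie G, Y \in U -> brk X Y \in U.

Definition subalgebra (G : lie_group) (U : {vspace lie G}) : Prop :=
  forall X Y : lie G, X \in U -> Y \in U -> brk X Y \in U.

Definition derived (G : lie_group) (U : {vspace lie G}) : {vspace lie G} :=
  <<[seq brk X Y | X <- vbasis U, Y <- vbasis U]>>%VS.

Definition solvable_alg (G : lie_group) (U : {vspace lie G}) : Prop :=
  exists n : nat, iter n (@derived G) U = 0%VS.

Definition semisimple (G : lie_group) : Prop :=
  forall U : {vspace lie G}, ideal U -> solvable_alg U -> U = 0%VS.

(* Degrees -nu, ..., nu are enumerated as [deg nu k], k < 2 nu + 1. *)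
Definition deg (nu k : nat) : int := k%:Z - nu%:Z.

Definition filt (G : lie_group) (nu : nat) (gr : int -> {vspace lie G})
    (i : int) : {vspace lie G} :=
  (\sum_(k < (2 * nu).+1 | (i <= deg nu k)%R) gr (deg nu k))%VS.

Record is_grading (G : lie_group) (nu : nat) (gr : int -> {vspace lie G}) :
  Prop := IsGrading {
  gr_out : forall j : int, nu%:Z < `|j| -> gr j = 0%VS;
  gr_direct : directv (\sum_(k < (2 * nu).+1) gr (deg nu k))%VS;
  gr_full : (\sum_(k < (2 * nu).+1) gr (deg nu k))%VS = fullv;
  gr_brk : forall (i j : int) (X Y : lie G),
    X \in gr i -> Y \in gr j -> brk X Y \in gr (i + j)%R;
  gr_gen : forall U : {vspace lie G}, subalgebra U -> (gr (-1) <= U)%VS ->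
    forall j : int, j < 0 -> (gr j <= U)%VS }.

(* The pair (G, P) with the grading of Lie(G).  [P] is a Lie group with an
   injective immersive homomorphism [incl] onto a closed subgroup of [G].  As
   usual in parabolic geometry (Cap-Slovak), a parabolic subgroup for a given
   grading lies between the intersection of the normalizers N_G(g^i) and the
   identity component of the latter: this is [incl_norm] together with
   [incl_lie], which reads Lie(P) = p = g^0. *)
Record parabolic_type := ParabolicType {
  pG : lie_group;
  pG_semisimple : semisimple pG;
  depth : nat;
  grad : int -> {vspace lie pG};
  grad_grading : is_grading depth grad;
  pP : lie_group;
  incl : pP -> pG;
  incl_mul : forall a b : pP, incl (gmul a b) = gmul (incl a) (incl b);
  incl_inj : injective incl;
  incl_smooth : smooth incl;
  incl_immersion :
    injective (dmap incl (gone pP : pP) : lie pP -> lie pG);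
  incl_closed : closed (range incl);
  incl_lie : forall X : lie pG,
    X \in filt depth grad 0 <->
    range (dmap incl (gone pP : pP) : lie pP -> lie pG) X;
  incl_norm : forall (h : pP) (i : int) (X : lie pG),
    X \in filt depth grad i -> Ad (incl h) X \in filt depth grad i }.

Definition gfilt (T : parabolic_type) (i : int) : {vspace lie (pG T)} :=
  filt (depth T) (@grad T) i.

(* The differential pP -> pG of [incl] on Lie algebras. *)
Definition incl_alg (T : parabolic_type) (A : lie (pP T)) : lie (pG T) :=
  dmap (@incl T) (gone (pP T) : pP T) A.

(* A finite list of triples (Z, W, v) stands for the 2-chain
   \sum Z /\ W (x) v in \bigwedge^2 p_+ (x) g. *)
Definition chain2 (G : lie_group) := seq (lie G * lie G * lie G).
(* A finite list of pairs (Z, v) stands for \sum Z (x) v in p_+ (x) g. *)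
Definition chain1 (G : lie_group) := seq (lie G * lie G).

(* The identifications p_+ = (g/p)^* are by the Killing form. *)
Definition form2 (G : lie_group) (c : chain2 G) (X Y : lie G) : lie G :=
  \sum_(t <- c) (killing t.1.1 X * killing t.1.2 Y
                 - killing t.1.1 Y * killing t.1.2 X) *: t.2.

Definition form1 (G : lie_group) (c : chain1 G) (X : lie G) : lie G :=
  \sum_(t <- c) killing t.1 X *: t.2.

(* Kostant codifferential:
   Z /\ W (x) v |-> Z (x) [W,v] - W (x) [Z,v] - [Z,W] (x) v. *)
Definition codiff (G : lie_group) (c : chain2 G) : chain1 G :=
  flatten [seq [:: (t.1.1, brk t.1.2 t.2);
                   (- t.1.2, brk t.1.1 t.2);
                   (- brk t.1.1 t.1.2, t.2)] | t <- c].

(* The 2-chain representing [phi] is unique in \bigwedge^2 p_+ (x) g, since the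
   Killing form pairs p_+ and g/p perfectly; its codifferential must vanish. *)
Definition codiff_free (T : parabolic_type)
    (phi : lie (pG T) -> lie (pG T) -> lie (pG T)) : Prop :=
  exists c : chain2 (pG T),
    [/\ forall t, t \in c -> t.1.1 \in gfilt T 1 /\ t.1.2 \in gfilt T 1,
        forall X Y, form2 c X Y = phi X Y
      & forall X, form1 (codiff c) X = 0].

End LieGroups.

Section ParabolicGeometry.
Variable K : numFieldType.

Record principal_bundle (P : lie_group K) (M : manifold K) := PrincipalBundle {
  btot :> manifold K;
  bproj : btot -> M;
  bact : btot -> P -> btot;
  bproj_smooth : smooth bproj;
  bact_smooth : smooth2 bact;
  bact1 : forall u, bact u (gone P) = u;
  bactM : forall u a b, bact (bact u a) b = bact u (gmul a b);
  bproj_act : forall u a, bproj (bact u a) = bproj u;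
  (* (bproj, tau) and theta are inverse P-equivariant diffeomorphisms between
     the part of the total space over U and U * P *)
  blocal : forall x : M, exists (U : set M) (tau : btot -> P)
      (theta : M -> P -> btot),
    [/\ open U /\ U x,
        smooth_on (bproj @^-1` U) tau /\ smooth2_on (U `*` setT) theta,
        forall y a, U y -> bproj (theta y a) = y /\ tau (theta y a) = a,
        forall u, U (bproj u) -> theta (bproj u) (tau u) = u
      & forall u a, U (bproj u) -> tau (bact u a) = gmul (tau u) a] }.

Record parabolic_geometry (T : parabolic_type K) (M : manifold K) :=
  ParabolicGeometry {
  bdl : principal_bundle (pP T) M;
  cartan : oneform bdl (mdim (pG T));
  cartan_smooth : smooth_of cartan;
  cartan_bij : forall u : bdl, bijective (cartan u);
  cartan_equiv : forall (u : bdl) (h : pP T) (v : tangent u),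
    cartan (bact u h) (dmap (fun w : bdl => bact w h) u v)
    = Ad (incl (ginv h)) (cartan u v);
  cartan_fund : forall (u : bdl) (A : lie (pP T)),
    cartan u (dmap (bact u) (gone (pP T) : pP T) A) = incl_alg A }.

Variables (T : parabolic_type K) (M : manifold K).
Variable geo : parabolic_geometry T M.

(* The curvature function, as a bilinear map on g (it is horizontal, hence
   descends to g/p). *)
Definition curvature (u : bdl geo) (X Y : lie (pG T)) : lie (pG T) :=
  let v := ((cartan (p := geo) u)^-1)%VF X in
  let w := ((cartan (p := geo) u)^-1)%VF Y in
  ext_d (cartan (p := geo)) u v w + brk X Y.

Definition regular_geometry : Prop :=
  forall (u : bdl geo) (i j : int) (X Y : lie (pG T)), i < 0 -> j < 0 ->
    X \in gfilt T i -> Y \in gfilt T j ->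
    curvature u X Y \in gfilt T (i + j + 1).

Definition normal_geometry : Prop :=
  forall u : bdl geo, codiff_free (curvature u).

Record is_symmetry (xi : vfield (bdl geo)) : Prop := IsSymmetry {
  sym_smooth : smooth_vf xi;
  sym_inv : forall (u : bdl geo) (h : pP T),
    xi (bact u h) = dmap (fun w : bdl geo => bact w h) u (xi u);
  sym_lie : forall (u : bdl geo) (v : tangent u),
    lie_der xi (cartan (p := geo)) u v = 0 }.

Definition sym_val (u : bdl geo) : set (lie (pG T)) :=
  [set cartan (p := geo) u (xi u) | xi in is_symmetry].

(* Dimension of a set of vectors that is a linear subspace. *)
Definition set_dim (A : set (lie (pG T))) : nat :=
  \dim (xget 0%VS [set U : {vspace lie (pG T)} | forall X, X \in U <-> A X]).

Definition dim_s (u : bdl geo) (j : int) : nat :=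
  (set_dim (sym_val u `&` [set X | X \in gfilt T j])
   - set_dim (sym_val u `&` [set X | X \in gfilt T (j + 1)]))%N.

(* [dim_s u j] depends only on [bproj u]; the value over [y] is expressed by
   quantifying over all [u] above [y], so that no choice is made. *)
Definition regular_point (x : M) : Prop :=
  exists2 N : set M, nbhs x N &
    forall j : int, - (depth T)%:Z <= j <= (depth T)%:Z ->
      exists d : nat, forall y : M, N y ->
        forall u : bdl geo, bproj u = y -> dim_s u j = d.

End ParabolicGeometry.

(* Main.v *)
Require Import Defs.
From HB Require Import structures.
From mathcomp Require Import all_boot all_order all_algebra.
From mathcomp Require Import complex zify.
From mathcomp Require Import all_classical all_reals all_analysis.

Set Implicit Arguments.
Unset Strict Implicit.
Unset Printing Implicit Defensive.

Import Order.TTheory GRing.Theory Num.Theory.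
Import numFieldNormedType.Exports.

Local Open Scope classical_set_scope.
Local Open Scope ring_scope.

(** Openness of the set of regular points is immediate: the neighbourhood that
    witnesses regularity of [x] witnesses it at each of its interior points.

    For density, let [f(u)] be the space of values [omega(xi(u))] of the
    infinitesimal symmetries and put [q_j(u) = dim (f(u) + g^j)], which is
    [dim g^j] plus the rank of the evaluation of symmetries at [u] modulo
    [g^j].  The dimension formula for sums and intersections gives
      [dim s_j(u) = (dim g^j - q_j(u)) - (dim g^(j+1) - q_(j+1)(u))],
    where [dim f(u)] cancels ([dim_s_sum]); so it is enough to make the finitely
    many functions [q_j] locally constant near a point of any given nonempty
    open set.

    Each [q_j] is lower semicontinuous ([sym_dim_lsc]): a basis of [f(u) + g^j]
    consists of values at [u] of continuous maps [w |-> omega(xi(w)) + Y], with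
    [Y] in [g^j], and linear independence is an open condition ([free_near]).  A
    finite family of bounded lower semicontinuous functions with values in the
    natural numbers is locally constant near a point where its sum is maximal
    on a given open set ([lsc_locally_constant]).

    This produces a point [u] of the total space, over the given open subset of
    [M], near which all [q_j] are constant.  To descend to [M], the projection is
    open because it has local sections ([bproj_nbhs]), and [q_j] is constant on
    fibres because [f(u h) = Ad(h^-1) f(u)] and [Ad(h^-1)] preserves the
    filtration ([sym_dim_fibre]). *)

(** * Subspaces and their dimensions *)

(** A subspace of maximal dimension among those contained in [A] must be all
    of [A]: adding the line of a further element of [A] would enlarge it. *)
Lemma linear_set_vspace (K : fieldType) (vT : vectType K) (A : set vT) :
  A 0 -> (forall a x y, A x -> A y -> A (a *: x + y)) ->
  exists U : {vspace vT}, forall x, x \in U <-> A x.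
Proof.
move=> A0 Alin.
pose P d := `[< exists U : {vspace vT}, [set` U] `<=` A /\ \dim U = d >].
have P0 : exists d, P d.
  exists 0%N; apply/asboolP; exists 0%VS; rewrite dimv0; split=> // x.
  by rewrite /= memv0 => /eqP ->.
have Pub d : P d -> (d <= \dim {: vT})%N.
  by case/asboolP=> U [_ <-]; exact/dimvS/subvf.
case: (ex_maxnP P0 Pub) => d /asboolP[U [UA dU]] dmax.
exists U => x; split=> [/UA //|Ax].
have : P (\dim (<[x]> + U)).
  apply/asboolP; exists (<[x]> + U)%VS.
  split=> // z /= /memv_addP[y /vlineP[k ->] [w Uw ->]].
  by apply: Alin => //; exact: UA.
move=> /dmax; rewrite -dU => le_dim.
have /eqP -> : U == (<[x]> + U)%VS by rewrite eqEdim addvSr.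
exact/(subvP (addvSl _ _))/memv_line.
Qed.

(** [\dim (F + W) - \dim W] is the dimension of the image of [F] modulo [W], and
    [L] induces a map from this image onto that of [L @: F].  The complement
    [F :\: W] of [F :&: W] in [F] stands for the quotient. *)
Lemma dim_limg_add (K : fieldType) (vT : vectType K) (L : 'End(vT))
    (F W : {vspace vT}) :
  (L @: W <= W)%VS -> (\dim (L @: F + W) <= \dim (F + W))%N.
Proof.
move=> LW.
have sub : (L @: F + W <= L @: (F :\: W) + W)%VS.
  rewrite subv_add addvSr andbT.
  apply: (@subv_trans _ _ (L @: (F :\: W + W))%VS).
    by rewrite addv_diff limgS ?addvSl.
  by rewrite limgD addvS.
apply: leq_trans (dimvS sub) _.
apply: leq_trans (dimv_add_leqif _ _) _.
have dim_img : (\dim (L @: (F :\: W)) <= \dim (F :\: W))%N.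
  by rewrite -(limg_ker_dim L (F :\: W)) leq_addl.
have := dimv_cap_compl F W; have := dimv_sum_cap F W; lia.
Qed.

(** * Semicontinuity of dimensions *)

Lemma det_continuous (K : numFieldType) (T : topologicalType) (n : nat)
    (A : T -> 'M[K]_n) (t : T) :
  (forall i j, {for t, continuous (fun s => A s i j)}) ->
  {for t, continuous (fun s => \det (A s))}.
Proof.
move=> cA; rewrite /determinant.
apply: cvg_big => [|p _]; first exact: add_continuous.
apply: cvgM; first exact: cvg_cst.
apply: cvg_big => [|i _]; first exact: mul_continuous.
exact: cA.
Qed.

(** The vectors are the rows of a matrix [A s]; independence at [t] provides a
    right inverse [B] of [A t], and [det (A s *m B)] remains nonzero near [t]. *)
Lemma free_near (K : numFieldType) (T : topologicalType) (n m : nat)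
    (v : 'I_m -> T -> 'rV[K]_n) (t : T) :
  (forall i j, {for t, continuous (fun s => v i s 0 j)}) ->
  free [tuple v i t | i < m] ->
  \forall s \near t, free [tuple v i s | i < m].
Proof.
move=> cv vt_free.
pose A s := \matrix_(i < m, j < n) v i s 0 j.
have mulA s (k : 'rV_m) : k *m A s = \sum_i k 0 i *: v i s.
  apply/rowP=> j; rewrite !mxE summxE.
  by apply: eq_bigr => i _; rewrite !mxE.
have tupE s (k : 'I_m -> K) :
    \sum_i k i *: [tuple v i s | i < m]`_i = \sum_i k i *: v i s.
  by apply: eq_bigr => i _; rewrite -tnth_nth tnth_mktuple.
have /row_freeP[B AB] : row_free (A t).
  apply: inj_row_free => k; rewrite mulA -tupE => k0.
  by apply/rowP => i; rewrite mxE; exact: (freeP vt_free _ k0).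
have cAB : {for t, continuous (fun s => \det (A s *m B))}.
  apply: det_continuous => i j.
  have -> : (fun s => (A s *m B) i j) = (fun s => \sum_l v i s 0 l * B l j).
    by apply/funext => s; rewrite mxE; apply: eq_bigr => l _; rewrite mxE.
  apply: cvg_big => [|l _]; first exact: add_continuous.
  by apply: cvgM; [exact: cv | exact: cvg_cst].
have : \forall s \near t, \det (A s *m B) != 0.
  by apply: (cvgr_neq0 _ cAB); rewrite AB det1 oner_neq0.
apply: filterS => s det_neq0; apply/freeP => k; rewrite tupE => k0.
have /eqP : (\row_i k i) *m A s *m B = 0.
  rewrite mulA (_ : \sum_i _ = 0) ?mul0mx // -[RHS]k0.
  by apply: eq_bigr => i _; rewrite mxE.
rewrite -mulmxA => /eqP /(congr1 (mulmx^~ (invmx (A s *m B)))).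
rewrite mul0mx mulmxK ?unitmxE ?unitfE // => /rowP kk i.
by have := kk i; rewrite !mxE.
Qed.

(** A subspace depending on a parameter cannot lose dimension locally when each
    of its vectors extends to a continuous selection: extend a basis. *)
Lemma dim_near (K : numFieldType) (T : topologicalType) (n : nat)
    (F : T -> {vspace 'rV[K]_n}) (t : T) :
  (forall x, x \in F t -> exists y : T -> 'rV[K]_n,
    [/\ y t = x, forall s, y s \in F s
      & forall j, {for t, continuous (fun s => y s 0 j)}]) ->
  \forall s \near t, (\dim (F t) <= \dim (F s))%N.
Proof.
move=> ext; have /choice[y yP] : forall i : 'I_(\dim (F t)),
    exists y : T -> 'rV[K]_n, [/\ y t = (vbasis (F t))`_i,
      forall s, y s \in F s & forall j, {for t, continuous (fun s => y s 0 j)}].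
  by move=> i; apply: ext; rewrite vbasis_mem // mem_nth // size_tuple.
have : free [tuple y i t | i < \dim (F t)].
  rewrite (_ : [tuple _ | _ < _] = vbasis (F t)).
    exact: basis_free (vbasisP _).
  apply: eq_from_tnth => i; rewrite tnth_mktuple (tnth_nth 0).
  by have [] := yP i.
move=> /(free_near _) near_free.
have /near_free : forall i j, {for t, continuous (fun s => y i s 0 j)}.
  by move=> i; have [] := yP i.
apply: filterS => s y_free; have := eqnP y_free; rewrite size_tuple => <-.
apply/dimvS/span_subvP => x /mapP[i _ ->].
by have [] := yP i.
Qed.

(** The values being integers, the sum of the family attains a maximum on [A].
    Near a point of maximum no function can decrease, by semicontinuity, and
    hence none can increase, as the sum would exceed its maximum. *)
Lemma lsc_locally_constant (T : topologicalType) (I : finType)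
    (r : I -> T -> nat) (b : nat) (A : set T) :
  (forall i t, (r i t <= b)%N) ->
  (forall i t, \forall s \near t, (r i t <= r i s)%N) ->
  open A -> A !=set0 ->
  exists2 t, A t & \forall s \near t, forall i, r i s = r i t.
Proof.
move=> rb r_lsc oA [t0 At0].
pose P d := `[< exists2 t, A t & (\sum_i r i t)%N = d >].
have P0 : exists d, P d by exists (\sum_i r i t0)%N; apply/asboolP; exists t0.
have Pub d : P d -> (d <= \sum_(i : I) b)%N.
  by case/asboolP=> t _ <-; exact: leq_sum.
case: (ex_maxnP P0 Pub) => d /asboolP[t At <-] dmax.
exists t => //; near=> s => i.
have le_rs : forall i, (r i t <= r i s)%N.
  by near: s; apply: filter_forall => k; exact: r_lsc.
have : (\sum_i r i s <= \sum_i r i t)%N.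
  apply: dmax; apply/asboolP; exists s => //.
  near: s; exact: open_nbhs_nbhs.
rewrite (bigD1 i) //= [X in (_ <= X)%N -> _](bigD1 i) //= => le_sum.
apply/eqP; rewrite eqn_leq le_rs andbT.
have le_rest : (\sum_(k | k != i) r k t <= \sum_(k | k != i) r k s)%N.
  exact: leq_sum.
by rewrite -(leq_add2r (\sum_(k | k != i) r k t)); apply: leq_trans le_sum;
  rewrite leq_add2l.
Unshelve. all: by end_near. Qed.

(** * Smooth functions on open sets *)

Section Smooth.
Variables (K : numFieldType) (E F : normedModType K).
Implicit Types (f g : E -> F) (D : set E).

(** The difference [g - f] vanishes near [x], so its differential there is 0. *)
Lemma near_eq_differentiable f g x :
  (\near x, f x = g x) -> differentiable f x -> differentiable g x.
Proof.
move=> fg df; pose h := g - f.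
have h0 : \forall y \near (0 : E), h (y + x) = 0.
  move: fg; rewrite (near_shift 0 x) subr0; apply: filterS => y /= fgy.
  by rewrite /h !fctE fgy subrr.
have h_small : h \o shift x = cst (h x) + (0 : E -> F) +o_ (0 : E) id.
  apply/eqaddoP => e e_gt0.
  have hx : h x = 0 by rewrite -(nbhs_singleton h0) add0r.
  near=> y; rewrite !fctE /= (near h0) // hx addr0 subr0 normr0.
  by rewrite mulr_ge0 // ltW.
have cont0 : continuous (0 : E -> F) by move=> y; exact: cvg_cst.
have dh : differentiable h x.
  by apply/diff_locallyP; rewrite (diff_unique cont0 h_small).
have -> : g = f + h by rewrite addrC subrK.
exact: differentiableD.
Unshelve. all: by end_near. Qed.

Lemma near_eq_diff f g x v : differentiable f x ->
  (\near x, f x = g x) -> 'd f x v = 'd g x v.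
Proof.
move=> df fg; have dg := near_eq_differentiable fg df.
by rewrite -!deriveE //; exact: near_eq_derive.
Qed.

(** The recursion in [Ck] goes through [x |-> 'd f x v], which off [D] takes
    arbitrary values.  Identities between differentials hold on [D] only, and
    this lemma is what allows rewriting with them. *)
Lemma Ck_ext k D f g : open D -> {in D, f =1 g} -> Ck k D f -> Ck k D g.
Proof.
move=> oD; have near_fg f' g' x : {in D, f' =1 g'} -> D x ->
    \near x, f' x = g' x.
  move=> fg Dx; near=> y; apply/fg/mem_set; near: y.
  exact: open_nbhs_nbhs.
elim: k f g => [|k IHk] f g fg /=.
  move=> cf x Dx; rewrite /prop_for /continuous_at -(fg _ (mem_set Dx)).
  apply: cvg_trans (cf x Dx); apply: near_eq_cvg; exact: near_fg.
case=> df Cdf; split=> [x Dx|v].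
  exact: near_eq_differentiable (near_fg _ _ _ fg Dx) (df x Dx).
apply: IHk (Cdf v) => x /set_mem Dx.
by apply: near_eq_diff; [exact: df | exact: near_fg].
Unshelve. all: by end_near. Qed.

Lemma Ck_cst k D (a : F) : Ck k D (fun=> a).
Proof.
elim: k a => [|k IHk] a /=; first by move=> x _; exact: cvg_cst.
split=> [x _|v]; first exact: differentiable_cst.
have -> : (fun x => 'd (fun=> a) x v) = (fun _ : E => 0 : F).
  by apply/funext => x; rewrite -/(cst a) diff_cst.
exact: IHk.
Qed.

Lemma diff_lincomb f g (a : K) x v :
  differentiable f x -> differentiable g x ->
  'd (a *: f + g) x v = a *: 'd f x v + 'd g x v.
Proof.
move=> df dg; have daf := differentiableZ a df.
by rewrite (diffD daf dg) /= (diffZ a df).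
Qed.

Lemma Ck_lin k D f g (a : K) : open D -> Ck k D f -> Ck k D g ->
  Ck k D (fun x => a *: f x + g x).
Proof.
move=> oD; elim: k f g => [|k IHk] f g /=.
  move=> cf cg x Dx; apply: cvgD; last exact: cg.
  by apply: cvgZr; exact: cf.
move=> [df Cdf] [dg Cdg].
have dcomb x : D x -> differentiable (a *: f + g) x.
  move=> Dx; apply: differentiableD; last exact: dg.
  by apply: differentiableZ; exact: df.
split=> [x /dcomb //|v].
apply: (@Ck_ext k D (fun x => a *: 'd f x v + 'd g x v)) => //; last exact: IHk.
move=> x /set_mem Dx; apply/esym.
by apply: diff_lincomb; [exact: df | exact: dg].
Qed.

Lemma Csmooth_differentiable D f x : Csmooth D f -> D x -> differentiable f x.
Proof. by move=> /(_ 1%N)[df _] /df. Qed.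

Lemma Csmooth_continuous D f x : Csmooth D f -> D x -> {for x, continuous f}.
Proof. by move=> /(_ 0%N); exact. Qed.

End Smooth.

(** * Vector fields and one-forms in charts *)

Lemma linear_combination_continuous (K : numFieldType) (T : topologicalType)
    (n m : nat) (v : T -> 'rV[K]_n) (b : 'I_n -> T -> 'rV[K]_m) (t : T) j :
  {for t, continuous v} -> (forall i, {for t, continuous (b i)}) ->
  {for t, continuous (fun s => \sum_i v s 0 i * b i s 0 j)}.
Proof.
move=> cv cb; apply: cvg_big => [|i _]; first exact: add_continuous.
apply: cvgM.
  exact: (continuous_comp cv (@coord_continuous _ _ _ 0 i _)).
exact: (continuous_comp (cb i) (@coord_continuous _ _ _ 0 j _)).
Qed.

Section Charts.
Variables (K : numFieldType) (M : manifold K).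
Implicit Types (x y z : M).

Lemma chart_image_nbhs (c : chart K (mdim M) M) x (A : set M) :
  cdom c x -> nbhs x A -> nbhs (cfun c x) (cfun c @` (A `&` cdom c)).
Proof.
move=> cx Ax.
have cod : (cfun c @` cdom c) (cfun c x) by exists x.
have cinvA : \forall e \near cfun c x, A (cinv c e).
  by apply: (cinv_cont cod); rewrite cfunK.
near=> e.
have [w cw we] : (cfun c @` cdom c) e.
  by near: e; apply: open_nbhs_nbhs; split => //; exact: ccod_open.
exists w => //; split=> //; rewrite -(cfunK cw) we.
by near: e.
Unshelve. all: by end_near. Qed.

Lemma trans_differentiable x y z : cdom (mchart y) x -> cdom (mchart z) x ->
  differentiable (trans (mchart y) (mchart z)) (cfun (mchart y) x).
Proof.
by move=> yx zx; apply: (Csmooth_differentiable (mtransP y z)); exists x.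
Qed.

(** The chain rule for the two transition maps between the charts, whose
    composite is the identity near the point. *)
Lemma diff_transK x y z v : cdom (mchart y) x -> cdom (mchart z) x ->
  'd (trans (mchart z) (mchart y)) (cfun (mchart z) x)
     ('d (trans (mchart y) (mchart z)) (cfun (mchart y) x) v) = v.
Proof.
move=> yx zx; set t := trans (mchart y) _; set t' := trans _ (mchart y).
set e := cfun (mchart y) x.
have te : t e = cfun (mchart z) x by rewrite /t /trans /= cfunK.
have dt : differentiable t e by exact: trans_differentiable.
have dt' : differentiable t' (t e) by rewrite te; exact: trans_differentiable.
rewrite -te -[LHS]/(('d t' (t e) \o 'd t e) v) -diff_comp //.
rewrite -deriveE; last exact: differentiable_comp.
rewrite (@near_eq_derive _ _ _ _ id); first by rewrite derive_id.
have : nbhs e (cfun (mchart y) @` (cdom (mchart z) `&` cdom (mchart y))).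
  apply: chart_image_nbhs => //; apply: open_nbhs_nbhs; split => //.
  exact: cdom_open.
apply: filterS => _ [w [zw yw] <-].
by rewrite /t /t' /trans /= !cfunK.
Qed.

Lemma vf_coordE (xi : vfield M) x0 x : cdom (mchart x0) x ->
  vf_coord xi x0 (cfun (mchart x0) x) =
  'd (trans (mchart x) (mchart x0)) (mpos x) (xi x).
Proof. by move=> x0x; rewrite /vf_coord cfunK. Qed.

Lemma of_coordE m (om : oneform M m) x0 x v : cdom (mchart x0) x ->
  of_coord om x0 (cfun (mchart x0) x) v =
  om x ('d (trans (mchart x0) (mchart x)) (cfun (mchart x0) x) v).
Proof. by move=> x0x; rewrite /of_coord cfunK. Qed.

(** The pairing of a one-form with a vector field is independent of the chart;
    reading it in the fixed chart of [x0] gives access to the smoothness of both,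
    since [om x (xi x)] itself refers to a chart that varies with [x]. *)
Lemma of_coord_vf_coord m (om : oneform M m) (xi : vfield M) x0 x :
  cdom (mchart x0) x ->
  of_coord om x0 (cfun (mchart x0) x) (vf_coord xi x0 (cfun (mchart x0) x)) =
  om x (xi x).
Proof.
by move=> x0x; rewrite of_coordE // vf_coordE // diff_transK //; exact: mchartP.
Qed.

Lemma oneform_continuous m (om : oneform M m) (xi : vfield M) x j :
  smooth_of om -> smooth_vf xi ->
  {for x, continuous (fun y => om y (xi y) 0 j)}.
Proof.
move=> om_smooth xi_smooth; pose c := mchart x.
have cx : cdom c x := mchartP x.
have cod : (cfun c @` cdom c) (cfun c x) by exists x.
pose f e := \sum_i vf_coord xi x e 0 i * of_coord om x e (delta_mx 0 i) 0 j.
have fE y : cdom c y -> f (cfun c y) = om y (xi y) 0 j.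
  move=> cy; rewrite -(of_coord_vf_coord om xi cy).
  (* Smoothness of a one-form is a condition on its values at constant vectors,
     hence the expansion in the standard basis. *)
  rewrite [in RHS](row_sum_delta (vf_coord _ _ _)) /f /of_coord.
  rewrite !linear_sum summxE; apply: eq_bigr => i _.
  by rewrite !linearZ mxE.
have cf : {for cfun c x, continuous f}.
  apply: linear_combination_continuous => [|i].
    by apply: (Csmooth_continuous (xi_smooth x)).
  by apply: (Csmooth_continuous (om_smooth x _)).
rewrite /prop_for /continuous_at -fE //.
have := continuous_comp (cfun_cont cx) cf.
apply: cvg_trans; apply: near_eq_cvg.
near=> y; rewrite /= fE //; near: y.
by apply: open_nbhs_nbhs; split => //; exact: cdom_open.
Unshelve. all: by end_near. Qed.

Definition vf_lin (a : K) (xi eta : vfield M) : vfield M :=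
  fun x => a *: (xi x : 'rV[K]_(mdim M)) + eta x.

Lemma vf_coord_lin a xi eta x0 :
  vf_coord (vf_lin a xi eta) x0 = a *: vf_coord xi x0 + vf_coord eta x0.
Proof.
apply/funext => e; rewrite /vf_coord /vf_lin; set q := cinv _ e.
set L := 'd _ _; exact: (linearP L a (xi q) (eta q)).
Qed.

Lemma vf_coord0 x0 : vf_coord (fun x : M => 0 : 'rV[K]_(mdim M)) x0 = fun=> 0.
Proof. by apply/funext => e; exact: linear0. Qed.

End Charts.

(** * The projection of a principal bundle *)

Section PrincipalBundle.
Variables (K : numFieldType) (P : lie_group K) (M : manifold K).
Variable B : principal_bundle P M.

(** The section [theta (-) (tau u)] of a local trivialization is continuous and
    passes through [u]; near [bproj u] it takes its values in [A]. *)
Lemma bproj_nbhs (u : B) (A : set B) :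
  nbhs u A -> nbhs (bproj u) (@bproj _ _ _ B @` A).
Proof.
move=> uA; have [U [tau [theta [[oU Uu] [_ [ctheta _]] inv1 inv2 _]]]] :=
  blocal B (bproj u).
pose a := tau u.
have c_theta : {for (bproj u, a),
    continuous (fun q : M * P => theta q.1 q.2)} by apply: ctheta.
have c_sec : {for bproj u, continuous (fun y => theta y a)}.
  apply: (@continuous_comp _ _ _ (fun y => (y, a))
           (fun q : M * P => theta q.1 q.2)) => //.
  by apply: cvg_pair; [exact: cvg_id | exact: cvg_cst].
have near_A : \forall y \near bproj u, A (theta y a).
  by apply: c_sec; rewrite inv2.
near=> y; exists (theta y a); first by near: y.
have Uy : U y by near: y; exact: open_nbhs_nbhs.
by have [] := inv1 y a Uy.
Unshelve. all: by end_near. Qed.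

Lemma bproj_surj (x : M) : exists u : B, bproj u = x.
Proof.
have [U [tau [theta [[_ Ux] _ inv1 _ _]]]] := blocal B x.
by exists (theta x (gone P)); have [] := inv1 x (gone P) Ux.
Qed.

(** In a trivialization around the fibre, the points have coordinates [tau u]
    and [tau w], which differ by right translation by [(tau u)^-1 (tau w)]. *)
Lemma fibre_transitive (u w : B) : bproj u = bproj w ->
  exists h : P, w = bact u h.
Proof.
move=> uw; have [U [tau [theta [[_ Uu] _ _ inv2 equiv]]]] := blocal B (bproj u).
exists (gmul (ginv (tau u)) (tau w)).
rewrite -[RHS]inv2 bproj_act // equiv // gmulA gmulV g1mul uw inv2 //.
by rewrite -uw.
Qed.

End PrincipalBundle.

(** * Values of infinitesimal symmetries *)

Section Symmetries.
Variables (K : numFieldType) (T : parabolic_type K) (M : manifold K).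
Variable geo : parabolic_geometry T M.
Implicit Types (u w : bdl geo) (xi eta : vfield (bdl geo)).

Lemma symmetry_lin a xi eta : is_symmetry xi -> is_symmetry eta ->
  is_symmetry (vf_lin a xi eta).
Proof.
move=> [xi_smooth xi_inv xi_lie] [eta_smooth eta_inv eta_lie].
have dvf zeta u : smooth_vf zeta -> differentiable (vf_coord zeta u) (mpos u).
  move=> /(_ u) /Csmooth_differentiable; apply; exists u => //.
  exact: mchartP.
split=> [u k|u h|u v].
- rewrite vf_coord_lin.
  by apply: Ck_lin; [exact: ccod_open | exact: xi_smooth | exact: eta_smooth].
- by rewrite /vf_lin /dmap linearP xi_inv eta_inv.
- have dE := diff_lincomb a v (dvf xi u xi_smooth) (dvf eta u eta_smooth).
  have := eta_lie u v; have := xi_lie u v; rewrite /lie_der vf_coord_lin.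
  set L := 'd (fun e => _) _ => xi0 eta0.
  apply: etrans (congr2 +%R erefl (congr1 (cartan u) dE)) _; rewrite /vf_lin.
  rewrite (linearP L) (linearP (cartan u)).
  by rewrite addrACA -scalerDr xi0 eta0 scaler0 addr0.
Qed.

Lemma symmetry0 : is_symmetry (fun u : bdl geo => 0 : 'rV[K]_(mdim (bdl geo))).
Proof.
split=> [u k|u h|u v].
- by rewrite vf_coord0; exact: Ck_cst.
- by rewrite /dmap linear0.
- by rewrite /lie_der vf_coord0 diff_cst !linear0 addr0.
Qed.

Lemma sym_val_vspace u :
  exists F : {vspace lie (pG T)}, forall X, X \in F <-> sym_val u X.
Proof.
apply: linear_set_vspace.
  by exists (fun=> 0); [exact: symmetry0 | rewrite linear0].
move=> a _ _ [xi xi_sym <-] [eta eta_sym <-].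
by exists (vf_lin a xi eta); [exact: symmetry_lin | rewrite /vf_lin linearP].
Qed.

Lemma set_dimE (A : set (lie (pG T))) (U : {vspace lie (pG T)}) :
  (forall X, X \in U <-> A X) -> set_dim A = \dim U.
Proof.
move=> UA; rewrite /set_dim; case: xgetP => [V _ VA|/(_ U) //].
congr (\dim _); apply/vspaceP => X; apply/idP/idP.
  by move=> /VA /UA.
by move=> /UA /VA.
Qed.

(** The term [\dim F] of the dimension formula occurs in both intersections and
    cancels.  The equation is stated additively to avoid truncated
    subtractions. *)
Lemma dim_s_sum u j (F : {vspace lie (pG T)}) :
  (forall X, X \in F <-> sym_val u X) ->
  (dim_s u j + (\dim (gfilt T (j + 1)) + \dim (F + gfilt T j)) =
   \dim (gfilt T j) + \dim (F + gfilt T (j + 1)))%N.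
Proof.
move=> FE; have capE i :
    set_dim (sym_val u `&` [set X | X \in gfilt T i]) = \dim (F :&: gfilt T i).
  apply: set_dimE => X; rewrite memv_cap; split.
    by move=> /andP[/FE].
  by move=> [/FE -> /= ->].
have gfiltS : (gfilt T (j + 1) <= gfilt T j)%VS.
  apply/subv_sumP => k jk; apply: sumv_sup (subvv _).
  by apply: le_trans jk; rewrite lerDl.
rewrite /dim_s !capE.
have := dimv_sum_cap F (gfilt T j); have := dimv_sum_cap F (gfilt T (j + 1)).
have := dimvS (capvS (subvv F) gfiltS); lia.
Qed.

Variable F : bdl geo -> {vspace lie (pG T)}.
Hypothesis FE : forall u X, X \in F u <-> sym_val u X.

Lemma sym_dim_lsc (W : {vspace lie (pG T)}) u :
  \forall w \near u, (\dim (F u + W) <= \dim (F w + W))%N.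
Proof.
apply: (dim_near (F := fun w => F w + W)%VS).
move=> _ /memv_addP[X /FE[xi xi_sym <-] [Y WY ->]].
exists (fun w => cartan w (xi w) + Y); split=> // [w|j].
  by apply: memv_add => //; apply/FE; exists xi.
have [xi_smooth _ _] := xi_sym.
have -> : (fun w => (cartan w (xi w) + Y) 0 j) =
    (fun w => cartan w (xi w) 0 j + Y 0 j) by apply/funext => w; rewrite mxE.
apply: cvgD; last exact: cvg_cst.
exact: oneform_continuous (cartan_smooth (p := geo)) xi_smooth.
Qed.

(** Invariance of the symmetries and equivariance of the Cartan connection put
    [F (bact u h)] in the image of [F u] under [Ad (h^-1)]. *)
Lemma sym_dim_act i u (h : pP T) :
  (\dim (F (bact u h) + gfilt T i) <= \dim (F u + gfilt T i))%N.
Proof.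
pose L : 'End(lie (pG T)) := linfun (fun X => Ad (Defs.incl (ginv h)) X).
have LE X : L X = Ad (Defs.incl (ginv h)) X.
  by rewrite /L lfunE.
apply: leq_trans (dim_limg_add _ _ (L := L)).
  apply/dimvS/addvS => //; apply/subvP => _ /FE[xi xi_sym <-].
  rewrite (sym_inv xi_sym) cartan_equiv -LE memv_img //.
  by apply/FE; exists xi.
apply/subvP => _ /memv_imgP[X WX ->]; rewrite LE; exact: incl_norm.
Qed.

(** [sym_dim_act] gives both inequalities, each point of a fibre being a
    translate of any other. *)
Lemma sym_dim_fibre i u w : bproj u = bproj w ->
  \dim (F u + gfilt T i) = \dim (F w + gfilt T i).
Proof.
have le_dim u1 u2 : bproj u1 = bproj u2 ->
    (\dim (F u2 + gfilt T i) <= \dim (F u1 + gfilt T i))%N.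
  by move=> /fibre_transitive[h ->]; exact: sym_dim_act.
by move=> uw; apply/eqP; rewrite eqn_leq !le_dim.
Qed.

End Symmetries.

Theorem lemma2p4p5 (R : realType) (K : numFieldType)
  (hK : K = R :> numFieldType \/ K = R[i] :> numFieldType)
  (T : parabolic_type K) (M : manifold K) (hM : connected [set: M])
  (geo : parabolic_geometry T M)
  (hreg : regular_geometry geo) (hnorm : normal_geometry geo) :
  open [set x : M | regular_point geo x] /\
  dense [set x : M | regular_point geo x].
Proof.
split.
  rewrite openE => x [N /nbhs_interior xN dimN].
  apply: filterS xN => y yN; exists N => //.
have /choice[F FE] := @sym_val_vspace K T M geo.
pose nu := depth T.
(* Indices go one beyond the top degree, since s_nu involves g^(nu+1). *)
pose filt_of (k : 'I_(2 * nu).+2) := gfilt T (deg nu k).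
pose r k (u : bdl geo) := \dim (F u + filt_of k)%VS.
move=> O [x0 Ox0] oO.
pose A := @bproj _ _ _ (bdl geo) @^-1` O.
have oA : open A.
  have [bproj_cont _] := bproj_smooth (bdl geo).
  by apply: open_comp => // u _; exact: bproj_cont.
have A0 : A !=set0.
  by have [u ux0] := bproj_surj (bdl geo) x0; exists u; rewrite /A /= ux0.
have r_le k u : (r k u <= \dim {: lie (pG T)})%N by exact/dimvS/subvf.
have r_lsc k u : \forall w \near u, (r k u <= r k w)%N by exact: sym_dim_lsc.
have [u Au r_const] := lsc_locally_constant r_le r_lsc oA A0.
exists (bproj u); split=> //.
exists (@bproj _ _ _ (bdl geo) @` [set w | forall k, r k w = r k u]).
  exact: bproj_nbhs.
move=> j /andP[nu_j j_nu].
have [k jE] : exists k : nat, j = deg nu k.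
  by exists (absz (j + nu%:Z)); rewrite /deg /nu; lia.
have k_lt : (k < (2 * nu).+1)%N.
  by move: j_nu; rewrite jE /deg -/nu; lia.
have k0_lt : (k < (2 * nu).+2)%N by exact: ltnW.
have j0E : filt_of (Ordinal k0_lt) = gfilt T j by rewrite jE.
have j1E : filt_of (Ordinal (k_lt : (k.+1 < (2 * nu).+2)%N)) = gfilt T (j + 1).
  by congr gfilt; rewrite jE /deg /=; lia.
exists (dim_s u j) => _ [w wr <-] w' w'w.
have dimE i l : filt_of l = gfilt T i ->
    \dim (F w' + gfilt T i) = \dim (F u + gfilt T i).
  by move=> <-; rewrite (sym_dim_fibre FE _ w'w); exact: wr.
have := dim_s_sum j (FE w'); have := dim_s_sum j (FE u).
rewrite (dimE _ _ j0E) (dimE _ _ j1E); lia.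
Qed.
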